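(* Let $T$ be the statement: ''For all $x,y\in\mathbb{R}$, if $\neg(x=y)$, then for every $z\in\mathbb{R}$ we have $\neg(x=z)$ or $\neg(y=z)$.'' Then $T$ is equivalent to WLLPO.
   Context: The equivalence is to be proved within Bishop-style constructive mathematics (intuitionistic logic; the law of excluded middle is not available). WLLPO (Weaker Lesser Limited Principle of Omniscience) is the statement: if $\alpha\in\{0,1\}^{\mathbb{N}}$ contains at most one $1$ and $\neg(\forall n:\alpha_n=0)$, then either $\forall n:\alpha_{2n}=0$ or $\forall n:\alpha_{2n+1}=0$. A real number $x$ is a sequence $(x_n)_n$ of closed intervals with rational endpoints that is nested ($x_{n+1}\subseteq x_n$ for all $n$) and dwindling (for all $n$ there is an $m$ such that $x_k$ has length less than $1/2^n$ whenever $k\geq m$). Two real numbers $x,y$ are equal, written $x=y$, if for all $n$ the intersection $x_n\cap y_n$ contains a rational number. *)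

(* Defs.v *)
From mathcomp Require Import all_boot all_order all_algebra.
Set Implicit Arguments. Unset Strict Implicit. Unset Printing Implicit Defensive.
Import Order.TTheory GRing.Theory Num.Theory.
Local Open Scope ring_scope.

(* Constructive reals as sequences of rational intervals                      *)

(* A closed rational interval is nonempty and may be degenerate. *)
Record rinterval := RInterval { lo : rat; hi : rat; lo_le_hi : lo <= hi }.

Definition itv (i : rinterval) : interval rat := `[lo i, hi i].

Definition len (i : rinterval) : rat := hi i - lo i.

Definition nested (x : nat -> rinterval) : Prop :=
  forall n, {subset itv (x n.+1) <= itv (x n)}.

Definition dwindling (x : nat -> rinterval) : Prop :=
  forall n, exists m, forall k, (m <= k)%N -> len (x k) < 1 / 2 ^+ n.

Record real := Real {
  approx :> nat -> rinterval;
  real_nested : nested approx;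
  real_dwindling : dwindling approx }.

Definition real_eq (x y : real) : Prop :=
  forall n, exists q : rat, q \in itv (x n) /\ q \in itv (y n).

Definition at_most_one (a : nat -> bool) : Prop :=
  forall m n, a m = true -> a n = true -> m = n.

Definition WLLPO : Prop :=
  forall a : nat -> bool,
    at_most_one a -> ~ (forall n, a n = false) ->
    (forall n, a (2 * n)%N = false) \/ (forall n, a (2 * n + 1)%N = false).

Definition T : Prop :=
  forall x y : real, ~ real_eq x y ->
  forall z : real, ~ real_eq x z \/ ~ real_eq y z.

(* The same statements in an arbitrary complete Heyting algebra               *)

(* Under excluded middle T and WLLPO both hold, so a proof of [T <-> WLLPO]
   that uses a classical axiom says nothing about constructive mathematics.
   To express that the equivalence is intuitionistic whatever the ambient
   logic, T and WLLPO are also interpreted with truth values in an arbitrary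
   complete Heyting algebra H, i.e. in the internal logic of the sheaf topos
   over H, where excluded middle, and WLLPO itself, fail in general.  For
   H := Prop (entailment being implication) this is the ordinary reading,
   with sequences presented as total single-valued relations. *)

(* Entailment is only a preorder: truth values are identified when they entail
   each other, as propositions are when they imply each other. *)
Record cHeyting := CHeyting {
  truth :> Type;
  entails : truth -> truth -> Prop;
  tt_top : truth;
  tt_bot : truth;
  tt_and : truth -> truth -> truth;
  tt_or : truth -> truth -> truth;
  tt_imp : truth -> truth -> truth;
  tt_all : forall A : Type, (A -> truth) -> truth;
  tt_ex : forall A : Type, (A -> truth) -> truth;
  entails_refl : forall p, entails p p;
  entails_trans : forall p q r, entails p q -> entails q r -> entails p r;
  entails_top : forall p, entails p tt_top;
  bot_entails : forall p, entails tt_bot p;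
  entails_and : forall p q r, entails r (tt_and p q) <-> entails r p /\ entails r q;
  or_entails : forall p q r, entails (tt_or p q) r <-> entails p r /\ entails q r;
  entails_imp : forall p q r, entails r (tt_imp p q) <-> entails (tt_and r p) q;
  entails_all : forall (A : Type) (F : A -> truth) r,
    entails r (tt_all F) <-> forall a, entails r (F a);
  ex_entails : forall (A : Type) (F : A -> truth) r,
    entails (tt_ex F) r <-> forall a, entails (F a) r }.

Arguments tt_top {c}.
Arguments tt_bot {c}.

Declare Scope truth_scope.
Delimit Scope truth_scope with truth.
Bind Scope truth_scope with truth.

Notation "p /\ q" := (tt_and p q) : truth_scope.
Notation "p \/ q" := (tt_or p q) : truth_scope.
Notation "p -> q" := (tt_imp p q) : truth_scope.
Notation "p <-> q" := (tt_and (tt_imp p q) (tt_imp q p)) : truth_scope.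
Notation "~ p" := (tt_imp p tt_bot) : truth_scope.
Notation "\all x .. y , p" := (tt_all (fun x => .. (tt_all (fun y => p)) ..))
  (at level 200, x binder, y binder, right associativity) : truth_scope.
Notation "\some x .. y , p" := (tt_ex (fun x => .. (tt_ex (fun y => p)) ..))
  (at level 200, x binder, y binder, right associativity) : truth_scope.

Section Internal.
Variable H : cHeyting.
Local Open Scope truth_scope.

Definition holds (p : H) : Prop := entails tt_top p.

(* The truth value of a proposition about constants (numbers, rationals,
   intervals): the supremum of top over the proofs of P. *)
Definition const (P : Prop) : H := \some _ : P, tt_top.

(* [f n a] is the truth value of "the n-th term is a". *)
Definition hseq (A : Type) : Type := nat -> A -> H.

Definition is_hseq (A : Type) (f : hseq A) : H :=
  (\all n : nat, \some a : A, f n a) /\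
  (\all (n : nat) (a b : A), f n a /\ f n b -> const (a = b)).

Definition hnested (x : hseq rinterval) : H :=
  \all (n : nat) (i j : rinterval),
    x n.+1 i /\ x n j -> const {subset itv i <= itv j}.

Definition hdwindling (x : hseq rinterval) : H :=
  \all n : nat, \some m : nat, \all (k : nat) (i : rinterval),
    const (m <= k)%N -> x k i -> const (len i < 1 / 2 ^+ n).

Definition is_hreal (x : hseq rinterval) : H :=
  is_hseq x /\ (hnested x /\ hdwindling x).

Definition hreal_eq (x y : hseq rinterval) : H :=
  \all n : nat, \some (i j : rinterval) (q : rat),
    (x n i /\ y n j) /\ (const (q \in itv i) /\ const (q \in itv j)).

Definition hat_most_one (a : hseq bool) : H :=
  \all m n : nat, a m true -> a n true -> const (m = n).

Definition hWLLPO : H :=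
  \all a : hseq bool, is_hseq a ->
    hat_most_one a -> ~ (\all n : nat, a n false) ->
    (\all n : nat, a (2 * n)%N false) \/ (\all n : nat, a (2 * n + 1)%N false).

Definition hT : H :=
  \all x y : hseq rinterval, is_hreal x -> is_hreal y -> ~ hreal_eq x y ->
  \all z : hseq rinterval, is_hreal z -> ~ hreal_eq x z \/ ~ hreal_eq y z.

End Internal.

(* Main.v *)
From mathcomp Require Import all_boot all_order all_algebra.
From mathcomp Require Import zify lra.
Require Import Defs.
Set Implicit Arguments. Unset Strict Implicit. Unset Printing Implicit Defensive.
Import Order.TTheory GRing.Theory Num.Theory.
Local Open Scope ring_scope.

(** T implies WLLPO.  Given a binary sequence [a] with at most one 1 and not
    everywhere 0, let [x] and [y] be the real numbers with binary digits [a k] at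
    the even, respectively odd, positions [k], and 0 elsewhere.  They differ: if
    [a k] were 1 then only one of [x], [y] would be nonzero, so [x = y] would force
    [a] to vanish everywhere.  T with [z = 0] yields that [x] or [y] is not zero.
    If [x] is not zero then no odd term of [a] can be 1, since it would be the only
    1 and [x] would be zero; the other case is the same (lemmas
    [expansions_differ], [expansion_nonzero], [expansions_decide]).

    WLLPO implies T.  Given [x], [y], [z] with [x] and [y] different, look for the
    first stage [n] at which the interval of [z] misses that of [x] or that of [y].
    Put a 1 at position [2n] if it misses that of [x], and at [2n+1] if it misses
    only that of [y].  This decidable search gives a sequence with at most one 1.
    If it vanished everywhere then [x = z] and [y = z], hence [x = y].  If its even
    terms vanish, then [y = z] is impossible, for it would make the odd terms vanish
    too; if its odd terms vanish, [x = z] is impossible for the same reason (lemmas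
    [first_stage_not_none], [first_stage_decides]).

    Both arguments are carried out with truth values in a complete Heyting algebra,
    in the style of Kripke-Joyal forcing: [G ||- p] says that [p] holds at stage
    [G], and implications, disjunctions and existential statements are used by
    passing to later stages, which are smaller elements of the algebra.  An internal
    sequence is a total single-valued relation and need not have external values,
    but every initial segment of it agrees with an external function at stages that
    cover the given one ([approximate]).  So each step that concerns finitely many terms becomes a
    statement on ordinary functions and rational numbers, and the new sequences
    are transforms [hmap F f] of given ones by operations [F] whose [n]-th term
    depends only on the terms up to [n].

    The ordinary equivalence is read off from the same lemmas in the algebra
    [propH] of propositions, with functions replaced by their graphs.  Only the
    relations that are constructed from graphs occur there, and these are graphs
    again ([presents_hmap]), so no choice principle is involved. *)

(** * Rational intervals *)

Definition apart (i j : rinterval) : bool := (hi i < lo j) || (hi j < lo i).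

Lemma mem_itvE (i : rinterval) (q : rat) : (q \in itv i) = (lo i <= q <= hi i).
Proof. by rewrite in_itv. Qed.

(** Equality of real numbers thus says that a decidable property fails at every
    index, which is what makes the search for a first index possible. *)
Lemma meet_notP (i j : rinterval) :
  (exists q : rat, q \in itv i /\ q \in itv j) <-> ~~ apart i j.
Proof.
rewrite /apart negb_or -!leNgt; split.
  by case=> q; rewrite !mem_itvE => -[/andP[? ?] /andP[? ?]]; lra.
move=> /andP[ji ij]; have := lo_le_hi i; have := lo_le_hi j => ? ?.
case: (lerP (lo i) (lo j)) => h; [exists (lo j)|exists (lo i)];
  by rewrite !mem_itvE; split; lra.
Qed.

Lemma sub_itv_bounds (i j : rinterval) :
  {subset itv i <= itv j} -> lo j <= lo i /\ hi i <= hi j.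
Proof.
move=> ij; have := ij (lo i); have := ij (hi i); have := lo_le_hi i.
by rewrite !mem_itvE => *; lra.
Qed.

Lemma dyadic_gt0 n : 0 < 1 / 2 ^+ n :> rat.
Proof. by rewrite divr_gt0 // exprn_gt0. Qed.

Lemma dyadic_half n : 1 / 2 ^+ n = 1 / 2 ^+ n.+1 + 1 / 2 ^+ n.+1 :> rat.
Proof.
have -> : 1 / 2 ^+ n.+1 = (1 / 2 ^+ n) / 2 :> rat.
  by rewrite exprSr invfM mulrA.
lra.
Qed.

Lemma dyadic_le m n : (m <= n)%N -> 1 / 2 ^+ n <= 1 / 2 ^+ m :> rat.
Proof.
elim: n => [|n IH]; first by case: m.
rewrite leq_eqVlt => /orP[/eqP -> //|/IH h].
have := dyadic_half n; have := dyadic_gt0 n.+1; lra.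
Qed.

Lemma dyadic_small (d : rat) : 0 < d -> exists n, 1 / 2 ^+ n < d.
Proof.
move=> d0; exists (Num.Def.archi_bound d^-1).
have := @upper_nthrootP rat d^-1 _ (leqnn _); set b := Num.Def.archi_bound _.
by move=> h; rewrite div1r -(invrK d) ltf_pV2 ?posrE ?invr_gt0 ?exprn_gt0.
Qed.

(** An interval shorter than the gap between [i] and [j] cannot meet both. *)
Lemma apart_gap (i j : rinterval) : apart i j ->
  exists n, forall i' j' k : rinterval,
    {subset itv i' <= itv i} -> {subset itv j' <= itv j} ->
    len k < 1 / 2 ^+ n -> ~~ apart i' k -> apart j' k.
Proof.
move=> ij.
have [|n ltn] := @dyadic_small (Num.max (lo j - hi i) (lo i - hi j)).
  by case/orP: ij => ?; rewrite lt_max; apply/orP; [left|right]; lra.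
exists n => i' j' k /sub_itv_bounds[? ?] /sub_itv_bounds[? ?].
have := lo_le_hi i'; have := lo_le_hi j'; have := lo_le_hi k.
have := lo_le_hi i; have := lo_le_hi j.
rewrite /len /apart => *.
move: ltn; rewrite lt_max => /orP[?|?]; lra.
Qed.

(** * Binary expansions restricted to a parity *)

Definition digit (p : bool) (g : nat -> bool) (k : nat) : rat :=
  if (odd k == p) && g k then 1 / 2 ^+ k.+1 else 0.

Lemma dyadic_itv_subproof (l : rat) n : l <= l + 1 / 2 ^+ n.
Proof. by rewrite lerDl ltW ?dyadic_gt0. Qed.

Definition dyadic_itv (l : rat) (n : nat) : rinterval :=
  RInterval (dyadic_itv_subproof l n).

Definition expansion (p : bool) (g : nat -> bool) (n : nat) : rinterval :=
  dyadic_itv (\sum_(k < n.+1) digit p g k) n.+1.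

Lemma digit_ge0 p g k : 0 <= digit p g k.
Proof. by rewrite /digit; case: ifP => // _; rewrite ltW ?dyadic_gt0. Qed.

Lemma expansion_nested p g n :
  {subset itv (expansion p g n.+1) <= itv (expansion p g n)}.
Proof.
move=> q; rewrite !mem_itvE /= [in X in X -> _]big_ord_recr /=.
set s := \sum_(i < _) _; have := dyadic_half n.+1; have := dyadic_gt0 n.+2.
by rewrite /digit; case: ifP => _ *; lra.
Qed.

Lemma expansion_len p g n k : (n <= k)%N -> len (expansion p g k) < 1 / 2 ^+ n.
Proof.
move=> nk; rewrite /len /=; set s := \sum_(i < _) _.
have := dyadic_le nk; have := dyadic_half k; have := dyadic_gt0 k.+1; lra.
Qed.

Lemma expansion_lo0 p (g : nat -> bool) n :
  (forall k, (k <= n)%N -> odd k = p -> g k = false) -> lo (expansion p g n) = 0.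
Proof.
move=> g0; rewrite /= big1 // => -[k kn] _; rewrite /digit /=.
by case: eqP => //= /g0 ->.
Qed.

Lemma expansion_lo_ge p (g : nat -> bool) k n :
  (k <= n)%N -> odd k = p -> g k -> 1 / 2 ^+ k.+1 <= lo (expansion p g n).
Proof.
move=> kn kp gk; rewrite /= (bigD1 (Ordinal (kn : (k < n.+1)%N))) //=.
rewrite {1}/digit kp eqxx gk /= lerDl sumr_ge0 // => *; exact: digit_ge0.
Qed.

Definition zero_itv : rinterval := RInterval (lexx (0 : rat)).

(** The expansion that contains the 1 is at least [1 / 2 ^ k.+1], while the other
    one has only digits 0 and so is confined to [[0, 1 / 2 ^ k.+2]] at stage
    [k.+1]. *)
Lemma expansions_apart (g : nat -> bool) k :
  g k -> (forall m, (m <= k.+1)%N -> g m -> m = k) ->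
  apart (expansion false g k.+1) (expansion true g k.+1).
Proof.
move=> gk only; have lo0 : lo (expansion (~~ odd k) g k.+1) = 0.
  apply: expansion_lo0 => m mk om; case E : (g m) => //.
  by move: om; rewrite (only m mk E); case: (odd k).
have := expansion_lo_ge (leqnSn k) erefl gk.
have := dyadic_half k.+1; have := dyadic_gt0 k.+2.
move: lo0; rewrite /apart; case: (odd k) => /= ->; lra.
Qed.

Lemma expansion_meets_zero p (g : nat -> bool) n :
  (forall k, (k <= n)%N -> odd k = p -> g k = false) ->
  ~~ apart (expansion p g n) zero_itv.
Proof.
move=> /expansion_lo0 h; rewrite /apart /= in h *; rewrite h.
have := dyadic_gt0 n.+1; lra.
Qed.

(** * The first stage at which one of two pairs of intervals is apart *)

Definition iv3 : Type := (rinterval * rinterval * rinterval)%type.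

Definition apart_xz (t : iv3) : bool := apart t.1.1 t.2.
Definition apart_yz (t : iv3) : bool := apart t.1.2 t.2.

(** The stage is [m./2]; the parity of [m] tells which of the two pairs is apart,
    with preference for the first pair so that there is at most one such [m]. *)
Definition first_apart (g : nat -> iv3) (m : nat) : bool :=
  let n := m./2 in
  (if odd m then apart_yz (g n) && ~~ apart_xz (g n) else apart_xz (g n)) &&
  all (fun k => ~~ (apart_xz (g k) || apart_yz (g k))) (iota 0 n).

Lemma first_apart_halves (g : nat -> iv3) m n :
  first_apart g m -> first_apart g n -> (m./2 <= n./2)%N.
Proof.
case/andP=> _ /allP mP /andP[nP _]; rewrite leqNgt; apply/negP=> nm.
have := mP n./2; rewrite mem_iota /= add0n => /(_ nm).
by move: nP; case: (odd n) => [/andP[-> _]|->]; rewrite ?orbT.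
Qed.

Lemma first_apart_at_most_one (g : nat -> iv3) m n :
  first_apart g m -> first_apart g n -> m = n.
Proof.
move=> gm gn; have mn : m./2 = n./2.
  by apply/eqP; rewrite eqn_leq !(first_apart_halves (g := g)).
have om : odd m = odd n.
  case/andP: gm => + _; case/andP: gn => + _; rewrite mn.
  case: (odd m); case: (odd n) => //; first by move=> ->; rewrite andbF.
  by move=> /andP[_ /negbTE ->].
by rewrite -(odd_double_half m) -(odd_double_half n) mn om.
Qed.

Lemma first_apart_none (g : nat -> iv3) n :
  (forall m, (m <= n.*2.+1)%N -> first_apart g m = false) ->
  forall k, (k <= n)%N -> ~~ apart_xz (g k) && ~~ apart_yz (g k).
Proof.
move=> none; elim/ltn_ind => k IH kn.
have before : all (fun j => ~~ (apart_xz (g j) || apart_yz (g j))) (iota 0 k).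
  apply/allP=> j; rewrite mem_iota /= add0n negb_or => jk.
  exact: IH jk (ltnW (leq_trans jk kn)).
have := none k.*2; have := none k.*2.+1.
rewrite /first_apart /= odd_double uphalf_double doubleK before !andbT /=.
rewrite ltnS leq_double kn leqW ?leq_double // => hy hx.
by move: (hy isT); rewrite hx // andbT => ->.
Qed.

Lemma first_apart_xz (g : nat -> iv3) m :
  first_apart g m -> ~~ odd m -> apart_xz (g m./2).
Proof. by case/andP=> + _ => /[swap] /negbTE ->. Qed.

Lemma first_apart_yz (g : nat -> iv3) m :
  first_apart g m -> odd m -> apart_yz (g m./2).
Proof. by case/andP=> + _ => /[swap] -> /andP[]. Qed.

(** * Forcing *)

Notation "G ||- p" := (entails G p%truth) (at level 79, no associativity).

(** The element [G] of the algebra is a stage, [D ||- G] says that [D] is a later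
    stage, and what is forced at [G] stays forced at [D]. *)
Section Forcing.
Variable H : cHeyting.
Implicit Types (G D p q : H).

Lemma imp_intro G p q :
  (forall D, D ||- G -> D ||- p -> D ||- q) -> G ||- (p -> q).
Proof.
move=> h; apply/entails_imp.
have /entails_and[l r] := entails_refl (tt_and G p).
exact: h l r.
Qed.

Lemma imp_elim G p q : G ||- (p -> q) -> G ||- p -> G ||- q.
Proof.
move=> /entails_imp pq hp; apply: entails_trans pq; apply/entails_and.
by split=> //; apply: entails_refl.
Qed.

Lemma and_intro G p q : G ||- p -> G ||- q -> G ||- (p /\ q).
Proof. by move=> *; apply/entails_and. Qed.

Lemma and_elim G p q : G ||- (p /\ q) -> G ||- p /\ G ||- q.
Proof. by move/entails_and. Qed.

Lemma or_introl G p q : G ||- p -> G ||- (p \/ q).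
Proof.
by move=> h; apply: entails_trans h _; case/or_entails: (entails_refl (tt_or p q)).
Qed.

Lemma or_intror G p q : G ||- q -> G ||- (p \/ q).
Proof.
by move=> h; apply: entails_trans h _; case/or_entails: (entails_refl (tt_or p q)).
Qed.

Lemma or_elim G p q r : G ||- (p \/ q) ->
  (forall D, D ||- G -> D ||- p -> D ||- r) ->
  (forall D, D ||- G -> D ||- q -> D ||- r) -> G ||- r.
Proof.
move=> pq hp hq; apply: imp_elim (entails_refl G).
apply: entails_trans pq _; apply/or_entails.
by split; apply: imp_intro => D l r'; [apply: hp|apply: hq].
Qed.

Lemma all_intro A (F : A -> H) G : (forall a, G ||- F a) -> G ||- (\all a, F a).
Proof. by move=> ?; apply/entails_all. Qed.

Lemma all_elim A (F : A -> H) G : G ||- (\all a, F a) -> forall a, G ||- F a.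
Proof. by move/entails_all. Qed.

Lemma ex_intro A (F : A -> H) G a : G ||- F a -> G ||- (\some a, F a).
Proof.
move=> h; apply: entails_trans h _.
exact: (proj1 (ex_entails F _) (entails_refl _)).
Qed.

(** Since the conclusion is itself a truth value, a witness may be taken to exist
    externally, after passing to a later stage. *)
Lemma ex_elim A (F : A -> H) G r : G ||- (\some a, F a) ->
  (forall a D, D ||- G -> D ||- F a -> D ||- r) -> G ||- r.
Proof.
move=> hF h; apply: imp_elim (entails_refl G).
apply: entails_trans hF _; apply/ex_entails => a.
by apply: imp_intro => D l r'; apply: h l.
Qed.

Lemma const_intro G (P : Prop) : P -> G ||- const H P.
Proof. by move=> h; apply: (@ex_intro P _ G h); apply: entails_top. Qed.

(** Constants are eliminated without passing to a later stage, so a decidable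
    statement about rationals may be used as in ordinary mathematics. *)
Lemma const_elim G (P : Prop) r : G ||- const H P -> (P -> G ||- r) -> G ||- r.
Proof.
by move=> hP h; apply: (ex_elim hP) => a D DG _; apply: entails_trans DG (h a).
Qed.

Lemma bot_elim G r : G ||- tt_bot -> G ||- r.
Proof. by move=> h; apply: entails_trans h (bot_entails r). Qed.

(** The bound on [k] lets the constants be eliminated one at a time, so that a
    fact about a whole finite approximation becomes available externally. *)
Lemma const_bounded G (P : nat -> Prop) N :
  (forall k, (k <= N)%N -> G ||- const H (P k)) ->
  G ||- const H (forall k, (k <= N)%N -> P k).
Proof.
elim: N => [|N IH] h.
  apply: (const_elim (h 0%N isT)) => P0; apply: const_intro => k.
  by rewrite leqn0 => /eqP ->.
apply: (const_elim (IH _)) => [k kN|PN]; first by apply: h; apply: leqW.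
apply: (const_elim (h N.+1 (leqnn _))) => PS; apply: const_intro => k.
by rewrite leq_eqVlt => /orP[/eqP -> //|/PN].
Qed.

End Forcing.

(** * Finite approximations of internal sequences *)

(** An external function that gives the terms of [f] up to [N] as seen at stage
    [G]. *)
Definition agree (H : cHeyting) A (G : H) (f : hseq H A) (g : nat -> A) N : Prop :=
  forall k, (k <= N)%N -> G ||- f k (g k).

Definition causal A B (F : (nat -> A) -> nat -> B) : Prop :=
  forall g h n, (forall k, (k <= n)%N -> g k = h k) -> F g n = F h n.

(** The term of index [n] is computed from any external function that agrees with
    [f] up to [n]; for causal [F] the choice of that function is immaterial. *)
Definition hmap (H : cHeyting) A B (F : (nat -> A) -> nat -> B) (f : hseq H A) :
    hseq H B :=
  fun n b => (\some g : nat -> A,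
    (\all k : nat, const H (k <= n)%N -> f k (g k)) /\ const H (F g n = b))%truth.

Lemma agree_later (H : cHeyting) A (G D : H) (f : hseq H A) g N :
  D ||- G -> agree G f g N -> agree D f g N.
Proof. by move=> DG fg k /fg; apply: entails_trans. Qed.

Lemma agree_le (H : cHeyting) A (G : H) (f : hseq H A) g M N :
  (M <= N)%N -> agree G f g N -> agree G f g M.
Proof. by move=> MN fg k kM; apply: fg; apply: leq_trans MN. Qed.

(** Transports all that is known at an earlier stage to the later one. *)
Ltac move_to l :=
  match type of l with entails ?D ?G =>
    repeat match goal with
    | h : entails G _ |- _ => apply (entails_trans l) in h
    | h : agree G ?f ?g ?n |- _ => apply (agree_later l) in h
    end; clear l
  end.

Section Sequences.
Variables (H : cHeyting) (A B : Type).
Implicit Types (G D r : H) (f : hseq H A) (g h : nat -> A).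

Lemma hseq_det G f n a b r :
  G ||- is_hseq f -> G ||- f n a -> G ||- f n b -> (a = b -> G ||- r) -> G ||- r.
Proof.
move=> /and_elim[_ det] fa fb; apply: const_elim.
by apply: imp_elim (all_elim (all_elim (all_elim det n) a) b) (and_intro fa fb).
Qed.

Lemma hseq_total G f n r : G ||- is_hseq f ->
  (forall a D, D ||- G -> D ||- f n a -> D ||- r) -> G ||- r.
Proof. by move=> /and_elim[tot _]; apply: ex_elim (all_elim tot n). Qed.

(** An internal sequence need not be given by an external function at any stage,
    but later stages at which a finite part of it is, one term after the other,
    cover the given stage. *)
Lemma approximate G f N r : G ||- is_hseq f ->
  (forall g D, D ||- G -> agree D f g N -> D ||- r) -> G ||- r.
Proof.
elim: N G r => [|N IH] G r fS h.
  apply: (hseq_total (n := 0%N) fS) => a D DG fa; apply: (h (fun=> a)) DG _ => k.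
  by rewrite leqn0 => /eqP ->.
apply: IH (fS) _ => g D DG fg; have fSD := entails_trans DG fS.
apply: (hseq_total (n := N.+1) fSD) => a D' D'D fa.
apply: (h (fun k => if (k <= N)%N then g k else a)); first exact: entails_trans D'D DG.
move=> k; rewrite leq_eqVlt => /orP[/eqP ->|]; first by rewrite ltnn.
by rewrite ltnS => kN; rewrite kN; apply: entails_trans D'D (fg _ _).
Qed.

Lemma agree_det G f g h N r :
  G ||- is_hseq f -> agree G f g N -> agree G f h N ->
  ((forall k, (k <= N)%N -> g k = h k) -> G ||- r) -> G ||- r.
Proof.
move=> fS fg fh; apply: const_elim; apply: const_bounded => k kN.
by apply: (hseq_det fS (fg k kN) (fh k kN)) => e; apply: const_intro.
Qed.

Variable F : (nat -> A) -> nat -> B.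

Lemma hmap_intro G f g n : agree G f g n -> G ||- hmap F f n (F g n).
Proof.
move=> fg; apply: (ex_intro (a := g)); apply: and_intro; last exact: const_intro.
apply: all_intro => k; apply: imp_intro => D DG kn.
by apply: (const_elim kn) => /fg; apply: entails_trans.
Qed.

Hypothesis causalF : causal F.

(** Terms of the transform may be replaced by those that [F] computes from an
    external approximation. *)
Lemma hmap_elim G f g N n b r :
  G ||- is_hseq f -> agree G f g N -> (n <= N)%N -> G ||- hmap F f n b ->
  (b = F g n -> G ||- r) -> G ||- r.
Proof.
move=> fS fg nN fb br; apply: (ex_elim fb) => h D DG /and_elim[fh hb].
apply: (const_elim hb) => {hb} hb.
apply: (agree_det (g := g) (h := h) (N := n) (entails_trans DG fS)).
- exact: agree_later DG (agree_le nN fg).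
- by move=> k kn; apply: imp_elim (all_elim fh k) (const_intro _ kn).
- move=> gh; apply: entails_trans DG (br _).
  by rewrite -hb; apply/esym/causalF.
Qed.

Lemma hmap_hseq G f : G ||- is_hseq f -> G ||- is_hseq (hmap F f).
Proof.
move=> fS; apply: and_intro.
  apply: all_intro => n; apply: (approximate (N := n) fS) => g D DG fg.
  exact: ex_intro (hmap_intro fg).
apply: all_intro => n; apply: all_intro => a; apply: all_intro => b.
apply: imp_intro => D DG /and_elim[fa fb]; move_to DG.
apply: (approximate (N := n) fS) => g D' D'D fg; move_to D'D.
apply: (hmap_elim fS fg (leqnn n) fa) => ->.
by apply: (hmap_elim fS fg (leqnn n) fb) => ->; apply: const_intro.
Qed.

End Sequences.

(** * Internal real numbers *)

Section Reals.
Variable H : cHeyting.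
Implicit Types (G D r : H) (x y z : hseq H rinterval).

Lemma hmap_real A (F : (nat -> A) -> nat -> rinterval) (f : hseq H A) G :
  causal F ->
  (forall g n, {subset itv (F g n.+1) <= itv (F g n)}) ->
  (forall g n k, (n <= k)%N -> len (F g k) < 1 / 2 ^+ n) ->
  G ||- is_hseq f -> G ||- is_hreal (hmap F f).
Proof.
move=> cF nest dwin fS; apply: and_intro; first exact: hmap_hseq.
apply: and_intro.
  apply: all_intro => n; apply: all_intro => i; apply: all_intro => j.
  apply: imp_intro => D DG /and_elim[fi fj]; move_to DG.
  apply: (approximate (N := n.+1) fS) => g D' D'D fg; move_to D'D.
  apply: (hmap_elim cF fS fg (leqnn _) fi) => ->.
  by apply: (hmap_elim cF fS fg (leqnSn _) fj) => ->; apply: const_intro.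
apply: all_intro => n; apply: (ex_intro (a := n)).
apply: all_intro => k; apply: all_intro => i.
apply: imp_intro => D DG nk; apply: imp_intro => D' D'D fi.
move_to DG; move_to D'D; apply: (const_elim nk) => {nk} nk.
apply: (approximate (N := k) fS) => g D'' D''D' fg; move_to D''D'.
by apply: (hmap_elim cF fS fg (leqnn k) fi) => ->; apply/const_intro/dwin.
Qed.

Lemma hreal_eq_intro G x y :
  (forall n D, D ||- G -> D ||- (\some i j : rinterval,
     (x n i /\ y n j) /\ const H (~~ apart i j))) ->
  G ||- hreal_eq x y.
Proof.
move=> h; apply: all_intro => n; apply: (ex_elim (h n G (entails_refl G))).
move=> i D DG hi; apply: (ex_elim hi) => j D' D'D /and_elim[xy ij].
apply: (const_elim ij) => /meet_notP[q [qi qj]].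
apply: (ex_intro (a := i)); apply: (ex_intro (a := j)); apply: (ex_intro (a := q)).
by do ![apply: and_intro => //]; apply: const_intro.
Qed.

Lemma hreal_eq_elim G x y n i j r :
  G ||- is_hseq x -> G ||- is_hseq y -> G ||- hreal_eq x y ->
  G ||- x n i -> G ||- y n j -> (~~ apart i j -> G ||- r) -> G ||- r.
Proof.
move=> xS yS xy xi yj; apply: const_elim.
apply: (ex_elim (all_elim xy n)) => i' D DG h; move_to DG.
apply: (ex_elim h) => j' D' D'D h'; move_to D'D.
apply: (ex_elim h') => q D'' D''D' /and_elim[/and_elim[xi' yj'] /and_elim[qi qj]].
move_to D''D'.
apply: (hseq_det xS xi xi') => ->; apply: (hseq_det yS yj yj') => ->.
apply: (const_elim qi) => {}qi; apply: (const_elim qj) => {}qj.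
by apply/const_intro/meet_notP; exists q.
Qed.

Lemma hreal_hseq G x : G ||- is_hreal x -> G ||- is_hseq x.
Proof. by move/and_elim=> []. Qed.

(** The nesting of consecutive intervals propagates because the internal sequence
    has, at a later stage, a term at each intermediate index. *)
Lemma hreal_nested G x m n i j r :
  G ||- is_hreal x -> (m <= n)%N -> G ||- x m i -> G ||- x n j ->
  ({subset itv j <= itv i} -> G ||- r) -> G ||- r.
Proof.
move=> /and_elim[xS /and_elim[nest _]] mn xi xj; apply: const_elim.
elim: n => [|n IH] in G j mn xj xS nest xi *.
  move: mn; rewrite leqn0 => /eqP m0; rewrite m0 in xi.
  by apply: (hseq_det xS xi xj) => ->; apply: const_intro.
move: mn; rewrite leq_eqVlt => /orP[/eqP mn|]; last rewrite ltnS => mn.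
  by rewrite -mn in xj; apply: (hseq_det xS xi xj) => ->; apply: const_intro.
apply: (hseq_total (n := n) xS) => k D DG xk; move_to DG.
apply: (const_elim (IH D k mn xk xS nest xi)) => ki.
have := all_elim (all_elim (all_elim nest n) j) k.
move=> /imp_elim/(_ (and_intro xj xk))/const_elim; apply => jk.
by apply: const_intro => q /jk /ki.
Qed.

(** If intervals of [x] and [y] were apart at some stage, choose [z] at a later
    stage shorter than the gap: its interval meets those of [x] and [y], which by
    nestedness lie inside the two separated ones. *)
Lemma hreal_eq_trans G x y z :
  G ||- is_hreal x -> G ||- is_hreal y -> G ||- is_hreal z ->
  G ||- hreal_eq x z -> G ||- hreal_eq y z -> G ||- hreal_eq x y.
Proof.
move=> xR yR zR xz yz; apply: hreal_eq_intro => n D DG; move_to DG.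
have xS := hreal_hseq xR; have yS := hreal_hseq yR; have zS := hreal_hseq zR.
apply: (hseq_total (n := n) xS) => i D' D'D xi; move_to D'D.
apply: (hseq_total (n := n) yS) => j D'' D''D' yj; move_to D''D'.
apply: (ex_intro (a := i)); apply: (ex_intro (a := j)).
apply: and_intro; first exact: and_intro.
case ij: (apart i j); last exact: const_intro.
have [e gap] := apart_gap ij.
have /and_elim[_ /and_elim[_ /all_elim/(_ e) dwin]] := zR.
apply: (ex_elim dwin) => m E1 E1' small; move_to E1'.
pose k := maxn m n.
apply: (hseq_total (n := k) xS) => i' E2 E2' xi'; move_to E2'.
apply: (hseq_total (n := k) yS) => j' E3 E3' yj'; move_to E3'.
apply: (hseq_total (n := k) zS) => l E4 E4' zl; move_to E4'.
have := all_elim (all_elim small k) l.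
move=> /imp_elim/(_ (const_intro _ (leq_maxl m n)))/imp_elim/(_ zl)/const_elim.
apply=> lsmall.
apply: (hreal_nested xR (leq_maxr m n) xi xi') => i'i.
apply: (hreal_nested yR (leq_maxr m n) yj yj') => j'j.
apply: (hreal_eq_elim xS zS xz xi' zl) => i'l.
apply: (hreal_eq_elim yS zS yz yj' zl) => j'l.
by move: j'l; rewrite (gap i' j' l).
Qed.

End Reals.

(** * From WLLPO to T *)

Lemma half_le n : (n./2 <= n)%N.
Proof. lia. Qed.

Lemma even_or_odd (n : nat) : {m | n = (2 * m)%N} + {m | n = (2 * m + 1)%N}.
Proof. by case on : (odd n); [right|left]; exists n./2; lia. Qed.

Lemma causal_first_apart : causal first_apart.
Proof.
move=> g h m gh; rewrite /first_apart !gh ?half_le //.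
congr (_ && _); apply: eq_in_all => k; rewrite mem_iota /= add0n => km.
by rewrite gh // ltnW // (leq_trans km) // half_le.
Qed.

Definition triple (H : cHeyting) (x y z : hseq H rinterval) : hseq H iv3 :=
  fun n t => ((x n t.1.1 /\ y n t.1.2) /\ z n t.2)%truth.

Definition first_stage (H : cHeyting) (x y z : hseq H rinterval) : hseq H bool :=
  hmap first_apart (triple x y z).

Section FirstStage.
Variables (H : cHeyting) (x y z : hseq H rinterval).
Implicit Types (G D : H).

Lemma triple_hseq G : G ||- is_hseq x -> G ||- is_hseq y -> G ||- is_hseq z ->
  G ||- is_hseq (triple x y z).
Proof.
move=> xS yS zS; apply: and_intro.
  apply: all_intro => n.
  apply: (hseq_total (n := n) xS) => i D DG xi; move_to DG.
  apply: (hseq_total (n := n) yS) => j D' D'D yj; move_to D'D.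
  apply: (hseq_total (n := n) zS) => k D'' D''D' zk; move_to D''D'.
  by apply: (ex_intro (a := (i, j, k))); do ![apply: and_intro => //].
apply: all_intro => n; apply: all_intro => -[[i j] k].
apply: all_intro => -[[i' j'] k']; apply: imp_intro => D DG /and_elim[]; move_to DG.
move=> /and_elim[/and_elim[xi yj] zk] /and_elim[/and_elim[xi' yj'] zk'].
apply: (hseq_det xS xi xi') => /= ->; apply: (hseq_det yS yj yj') => /= ->.
by apply: (hseq_det zS zk zk') => /= ->; apply: const_intro.
Qed.

Lemma first_stage_hseq G :
  G ||- is_hreal x -> G ||- is_hreal y -> G ||- is_hreal z ->
  G ||- is_hseq (first_stage x y z).
Proof.
move=> xR yR zR; apply: hmap_hseq; first exact: causal_first_apart.
by apply: triple_hseq; apply: hreal_hseq.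
Qed.

Lemma first_stage_at_most_one G :
  G ||- is_hreal x -> G ||- is_hreal y -> G ||- is_hreal z ->
  G ||- hat_most_one (first_stage x y z).
Proof.
move=> /hreal_hseq xS /hreal_hseq yS /hreal_hseq zS.
have wS := triple_hseq xS yS zS.
apply: all_intro => m; apply: all_intro => n.
apply: imp_intro => D DG am; apply: imp_intro => D' D'D an; move_to DG; move_to D'D.
apply: (approximate (N := maxn m n) wS) => g E ED' wg; move_to ED'.
apply: (hmap_elim causal_first_apart wS wg (leq_maxl m n) am) => gm.
apply: (hmap_elim causal_first_apart wS wg (leq_maxr m n) an) => gn.
by apply: const_intro; apply: (first_apart_at_most_one (g := g)); apply/esym.
Qed.

(** Up to stage [n] the vanishing of the search involves its terms of index at most
    [2n+1], hence a finite approximation. *)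
Lemma first_stage_none G :
  G ||- is_hreal x -> G ||- is_hreal y -> G ||- is_hreal z ->
  (forall n, G ||- first_stage x y z n false) ->
  G ||- hreal_eq x z /\ G ||- hreal_eq y z.
Proof.
move=> /hreal_hseq xS /hreal_hseq yS /hreal_hseq zS none.
have wS := triple_hseq xS yS zS.
have meets n D r : D ||- G ->
  (forall g D', D' ||- D -> agree D' (triple x y z) g n ->
     ~~ apart_xz (g n) && ~~ apart_yz (g n) -> D' ||- r) -> D ||- r.
  move=> DG hr; have wSD := entails_trans DG wS.
  apply: (approximate (N := n.*2.+1) wSD) => g D' D'D wg.
  have wn : agree D' (triple x y z) g n by apply: agree_le wg; lia.
  apply: (const_elim (P := forall m, (m <= n.*2.+1)%N -> first_apart g m = false)).
    move_to D'D; apply: const_bounded => m mn; have am := entails_trans DG (none m).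
    by apply: (hmap_elim causal_first_apart wSD wg mn am) => <-; apply: const_intro.
  by move=> /first_apart_none/(_ n (leqnn n)); apply: hr D'D wn.
split; apply: hreal_eq_intro => n D DG; apply: (meets n D _ DG) => g D' D'D wg;
  have /and_elim[/and_elim[xi yj] zk] := wg n (leqnn n); case/andP=> xzn yzn.
- apply: (ex_intro (a := (g n).1.1)); apply: (ex_intro (a := (g n).2)).
  by do ![apply: and_intro => //]; apply: const_intro.
- apply: (ex_intro (a := (g n).1.2)); apply: (ex_intro (a := (g n).2)).
  by do ![apply: and_intro => //]; apply: const_intro.
Qed.

Lemma first_stage_not_none G :
  G ||- is_hreal x -> G ||- is_hreal y -> G ||- is_hreal z ->
  G ||- (~ hreal_eq x y) -> G ||- (~ \all n : nat, first_stage x y z n false).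
Proof.
move=> xR yR zR xy; apply: imp_intro => D DG none; move_to DG.
have [xz yz] := first_stage_none xR yR zR (all_elim none).
exact: imp_elim xy (hreal_eq_trans xR yR zR xz yz).
Qed.

(** A 1 at an even position would witness that [x] and [z] are apart. *)
Lemma first_stage_even G n :
  G ||- is_hreal x -> G ||- is_hreal y -> G ||- is_hreal z ->
  G ||- hreal_eq x z -> G ||- first_stage x y z (2 * n) false.
Proof.
move=> /hreal_hseq xS /hreal_hseq yS /hreal_hseq zS xz.
have wS := triple_hseq xS yS zS.
apply: (approximate (N := (2 * n)%N) wS) => g D DG wg; move_to DG.
case E : (first_apart g (2 * n)); last by rewrite -E; apply: hmap_intro.
have := first_apart_xz E; rewrite oddM /= => /(_ isT).
have /and_elim[/and_elim[xi _] zk] := wg _ (half_le (2 * n)).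
by move=> apart_n; apply: (hreal_eq_elim xS zS xz xi zk) => /negP[].
Qed.

Lemma first_stage_odd G n :
  G ||- is_hreal x -> G ||- is_hreal y -> G ||- is_hreal z ->
  G ||- hreal_eq y z -> G ||- first_stage x y z (2 * n + 1) false.
Proof.
move=> /hreal_hseq xS /hreal_hseq yS /hreal_hseq zS yz.
have wS := triple_hseq xS yS zS.
apply: (approximate (N := (2 * n + 1)%N) wS) => g D DG wg; move_to DG.
case E : (first_apart g (2 * n + 1)); last by rewrite -E; apply: hmap_intro.
have := first_apart_yz E; rewrite oddD oddM /= => /(_ isT).
have /and_elim[/and_elim[_ yj] zk] := wg _ (half_le (2 * n + 1)).
by move=> apart_n; apply: (hreal_eq_elim yS zS yz yj zk) => /negP[].
Qed.

(** Each half of the search that vanishes excludes one equality: the equality would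
    silence the other half as well. *)
Lemma first_stage_decides G :
  G ||- is_hreal x -> G ||- is_hreal y -> G ||- is_hreal z ->
  G ||- (~ hreal_eq x y) ->
  G ||- ((\all n : nat, first_stage x y z (2 * n)%N false) \/
         (\all n : nat, first_stage x y z (2 * n + 1)%N false)) ->
  G ||- (~ hreal_eq x z \/ ~ hreal_eq y z).
Proof.
move=> xR yR zR /(first_stage_not_none xR yR zR) some dec.
apply: (or_elim dec) => D DG silent; move_to DG.
- apply/or_intror/imp_intro => D' D'D yz; move_to D'D.
  apply: imp_elim some (all_intro _) => n.
  case: (even_or_odd n) => -[m ->]; first exact: all_elim silent m.
  exact: first_stage_odd.
- apply/or_introl/imp_intro => D' D'D xz; move_to D'D.
  apply: imp_elim some (all_intro _) => n.
  case: (even_or_odd n) => -[m ->]; last exact: all_elim silent m.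
  exact: first_stage_even.
Qed.

End FirstStage.

(** * From T to WLLPO *)

Lemma causal_expansion p : causal (expansion p).
Proof.
move=> g h n gh; rewrite /expansion; congr dyadic_itv; apply: eq_bigr => -[k kn] _.
by rewrite /digit /= gh.
Qed.

(** Zero is presented as a transform, so that the lemmas on transforms apply to
    it; hence the first argument. *)
Definition zeros (g : nat -> bool) (n : nat) : rinterval := zero_itv.

Lemma causal_zeros : causal zeros.
Proof. by []. Qed.

Section Expansions.
Variables (H : cHeyting) (a : hseq H bool).
Implicit Types (G D : H).

Lemma expansion_hreal p G :
  G ||- is_hseq a -> G ||- is_hreal (hmap (expansion p) a).
Proof.
apply: hmap_real; [exact: causal_expansion|exact: expansion_nested|].
by move=> g n k; apply: expansion_len.
Qed.

Lemma zeros_hreal G : G ||- is_hseq a -> G ||- is_hreal (hmap zeros a).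
Proof.
apply: hmap_real; [exact: causal_zeros|by move=> g n q|move=> g n k _].
by rewrite /len /zeros /= subrr dyadic_gt0.
Qed.

(** If both expansions were equal, a 1 at position [n] could be refuted from the
    terms up to [n.+1] alone, where it is the only one. *)
Lemma expansions_differ G :
  G ||- is_hseq a -> G ||- hat_most_one a -> G ||- (~ \all n : nat, a n false) ->
  G ||- (~ hreal_eq (hmap (expansion false) a) (hmap (expansion true) a)).
Proof.
move=> aS one some; apply: imp_intro => D DG eq; move_to DG.
apply: imp_elim some (all_intro _) => n.
apply: (approximate (N := n.+1) aS) => g D' D'D ag; move_to D'D.
have an := ag n (leqnSn n); case gn : (g n) an => // an.
have eqR p := hreal_hseq (expansion_hreal p aS).
apply: (hreal_eq_elim (eqR _) (eqR _) eq (hmap_intro _ ag) (hmap_intro _ ag)) => meets.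
apply: (const_elim (P := forall m, (m <= n.+1)%N -> g m -> m = n)).
  apply: const_bounded => m mn; case gm : (g m); last exact: const_intro.
  have am := ag m mn; rewrite gm in am.
  have /imp_elim/(_ am)/imp_elim/(_ an) := all_elim (all_elim one m) n.
  by move/const_elim; apply => mn'; apply: const_intro.
by move=> only; rewrite (expansions_apart gn only) in meets.
Qed.

(** A one of parity [~~ p] leaves the expansion of parity [p] equal to zero. *)
Lemma expansion_nonzero p G n :
  G ||- is_hseq a -> G ||- hat_most_one a ->
  G ||- (~ hreal_eq (hmap (expansion p) a) (hmap zeros a)) ->
  odd n = ~~ p -> G ||- a n false.
Proof.
move=> aS one nz np; apply: (approximate (N := n) aS) => g D DG ag; move_to DG.
have an := ag n (leqnn n); case gn : (g n) an => // an.
apply: bot_elim; apply: imp_elim nz _; apply: hreal_eq_intro => m D' D'D; move_to D'D.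
apply: (approximate (N := m) aS) => h E ED' ah; move_to ED'.
apply: (ex_intro (a := expansion p h m)); apply: (ex_intro (a := zero_itv)).
apply: and_intro; first by apply: and_intro; exact: hmap_intro ah.
apply: (const_elim (P := forall k, (k <= m)%N -> odd k = p -> h k = false)).
  apply: const_bounded => k km; case hk : (h k); last exact: const_intro.
  have ak := ah k km; rewrite hk in ak.
  have /imp_elim/(_ ak)/imp_elim/(_ an) := all_elim (all_elim one k) n.
  by move/const_elim; apply => kn; apply: const_intro; rewrite kn np; case: (p).
by move=> h0; apply/const_intro/expansion_meets_zero.
Qed.

Lemma expansions_decide G :
  G ||- is_hseq a -> G ||- hat_most_one a ->
  G ||- (~ hreal_eq (hmap (expansion false) a) (hmap zeros a) \/
         ~ hreal_eq (hmap (expansion true) a) (hmap zeros a)) ->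
  G ||- ((\all n : nat, a (2 * n)%N false) \/ (\all n : nat, a (2 * n + 1)%N false)).
Proof.
move=> aS one dec; apply: (or_elim dec) => D DG nz; move_to DG.
- apply/or_intror/all_intro => n.
  by apply: expansion_nonzero nz _ => //; rewrite oddD oddM.
- apply/or_introl/all_intro => n.
  by apply: expansion_nonzero nz _ => //; rewrite oddM.
Qed.

End Expansions.

Lemma hT_iff_hWLLPO (H : cHeyting) : holds (hT H <-> hWLLPO H)%truth.
Proof.
apply: and_intro; apply: imp_intro => G _ hyp.
- apply: all_intro => a; apply: imp_intro => D DG aS; move_to DG.
  apply: imp_intro => D' D'D one; move_to D'D.
  apply: imp_intro => E ED' some; move_to ED'.
  apply: expansions_decide => //.
  have := all_elim (all_elim hyp (hmap (expansion false) a)) (hmap (expansion true) a).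
  move=> /imp_elim/(_ (expansion_hreal _ aS))/imp_elim/(_ (expansion_hreal _ aS)).
  move=> /imp_elim/(_ (expansions_differ aS one some))/all_elim/(_ (hmap zeros a)).
  by move=> /imp_elim/(_ (zeros_hreal aS)).
- apply: all_intro => x; apply: all_intro => y.
  apply: imp_intro => D DG xR; move_to DG; apply: imp_intro => D' D'D yR; move_to D'D.
  apply: imp_intro => E ED' xy; move_to ED'; apply: all_intro => z.
  apply: imp_intro => E' E'E zR; move_to E'E.
  apply: first_stage_decides => //.
  have /imp_elim/(_ (first_stage_hseq xR yR zR)) := all_elim hyp (first_stage x y z).
  move=> /imp_elim/(_ (first_stage_at_most_one xR yR zR)).
  by move=> /imp_elim/(_ (first_stage_not_none xR yR zR xy)).
Qed.

(** * The algebra of propositions *)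

(** Transparent, so that forcing in this algebra reduces to implication. *)
Definition propH : cHeyting.
Proof.
refine (@CHeyting Prop (fun p q => p -> q) True False and or (fun p q => p -> q)
  (fun A F => forall a : A, F a) (fun A F => exists a : A, F a) _ _ _ _ _ _ _ _ _);
  by [firstorder].
Defined.

(** Weaker than equality with the graph of [f], so that neither functional nor
    propositional extensionality is needed to recognize transforms. *)
Definition presents A (r : hseq propH A) (f : nat -> A) : Prop :=
  forall n a, (r n a : Prop) <-> f n = a.

Definition graph A (f : nat -> A) : hseq propH A := fun n a => f n = a.

Lemma const_propE (P : Prop) : (const propH P : Prop) <-> P.
Proof. by split=> [[]|p]; last exists p. Qed.

Lemma graph_presents A (f : nat -> A) : presents (graph f) f.
Proof. by []. Qed.

Section Presents.
Variables (A B : Type) (r : hseq propH A) (f : nat -> A).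
Hypothesis rf : presents r f.

Lemma presents_hseq : (is_hseq r : Prop).
Proof.
split=> [n|n a b [/rf <- /rf <-]]; last exact/const_propE.
by exists (f n); apply/rf.
Qed.

(** The function [f] is an approximation of itself to every order, so that the
    transform of its graph is the graph of its transform. *)
Lemma presents_hmap (F : (nat -> A) -> nat -> B) :
  causal F -> presents (hmap F r) (F f).
Proof.
move=> cF n b; split=> [[g [rg /const_propE <-]]|<-].
  by apply: cF => k kn; apply/rf/rg/const_propE.
by exists f; split=> [k _|]; [apply/rf|apply/const_propE].
Qed.

End Presents.

Lemma presents_at_most_one (r : hseq propH bool) (f : nat -> bool) :
  presents r f -> (hat_most_one r : Prop) <-> at_most_one f.
Proof.
move=> rf; split=> one m n.
  by move=> fm fn; apply/const_propE/one; apply/rf.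
by move=> /rf fm /rf fn; apply/const_propE/one.
Qed.

Lemma presents_hreal (r : hseq propH rinterval) (f : nat -> rinterval) :
  presents r f -> (is_hreal r : Prop) <-> nested f /\ dwindling f.
Proof.
move=> rf; split=> [[_ [nest dwin]]|[nest dwin]].
  split=> n; first by apply/const_propE/(nest n); split; apply/rf.
  have [m mP] := dwin n; exists m => k mk.
  by apply/const_propE/(mP k); [apply/const_propE|apply/rf].
split; first exact: presents_hseq rf.
split=> n; first by move=> i j [/rf <- /rf <-]; apply/const_propE/nest.
have [m mP] := dwin n; exists m => k i /const_propE mk /rf <-.
exact/const_propE/mP.
Qed.

Lemma presents_eq (r s : hseq propH rinterval) (x y : real) :
  presents r x -> presents s y -> (hreal_eq r s : Prop) <-> real_eq x y.
Proof.
move=> rx sy; split=> xy n.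
  have [i [j [q [[/rx <- /sy <-] [/const_propE ? /const_propE ?]]]]] := xy n.
  by exists q.
have [q [? ?]] := xy n; exists (x n), (y n), q.
by split; split; [apply/rx|apply/sy|apply/const_propE|apply/const_propE].
Qed.

Lemma real_hreal (x : real) : (is_hreal (graph x) : Prop).
Proof.
apply/(presents_hreal (graph_presents x)).
by split; [apply: real_nested|apply: real_dwindling].
Qed.

Lemma triple_presents (x y z : nat -> rinterval) :
  presents (triple (graph x) (graph y) (graph z)) (fun n => (x n, y n, z n)).
Proof.
move=> n [[i j] k]; split=> [[[/= xi yj] zk]|[<- <- <-]]; last by [].
by rewrite -xi -yj -zk.
Qed.

Lemma T_iff_WLLPO : T <-> WLLPO.
Proof.
split=> [t a one some|w x y xy z].
  have aS : tt_top ||- is_hseq (graph a) by move=> _; exact: presents_hseq (graph_presents a).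
  have aone : tt_top ||- hat_most_one (graph a).
    by move=> _; apply/(presents_at_most_one (graph_presents a)).
  (* [I] is a proof of the top truth value, the stage of the ordinary reading *)
  pose toreal F (c : causal F) (R : tt_top ||- is_hreal (hmap F (graph a))) :=
    let nd := proj1 (presents_hreal (presents_hmap (graph_presents a) c)) (R I) in
    Real (proj1 nd) (proj2 nd).
  pose X p := toreal _ (@causal_expansion p) (expansion_hreal p aS).
  pose Z := toreal _ causal_zeros (zeros_hreal aS).
  have pX p : presents (hmap (expansion p) (graph a)) (X p).
    exact: presents_hmap (@causal_expansion p).
  have pZ : presents (hmap zeros (graph a)) Z by exact: presents_hmap causal_zeros.
  have XX : ~ real_eq (X false) (X true).
    move=> /(presents_eq (pX _) (pX _)).
    exact: (expansions_differ aS aone (fun _ => some) I).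
  apply: (expansions_decide aS aone) => // _.
  by case: (t _ _ XX Z) => h; [left|right] => /(presents_eq (pX _) pZ).
have [xR yR zR] : [/\ tt_top ||- is_hreal (graph x), tt_top ||- is_hreal (graph y) &
    tt_top ||- is_hreal (graph z)] by split=> _; apply: real_hreal.
have pF := presents_hmap (triple_presents x y z) causal_first_apart.
have xy' : tt_top ||- (~ hreal_eq (graph x) (graph y)).
  by move=> _ /(presents_eq (graph_presents x) (graph_presents y)).
set a := first_apart _ in pF.
have dec : (forall n, a (2 * n)%N = false) \/ (forall n, a (2 * n + 1)%N = false).
  apply: w.
    by apply/(presents_at_most_one pF)/(first_stage_at_most_one xR yR zR).
  move=> none; apply: (first_stage_not_none xR yR zR xy' I) => n.
  exact/pF.
have [] // := first_stage_decides xR yR zR xy' _ I.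
- by case: dec => h _; [left|right] => n; apply/pF.
- by move=> h; left => /(presents_eq (graph_presents x) (graph_presents z)).
- by move=> h; right => /(presents_eq (graph_presents y) (graph_presents z)).
Qed.

Theorem proposition2p13 :
  (T <-> WLLPO) /\
  (forall H : cHeyting, holds (hT H <-> hWLLPO H)%truth).
Proof. by split; [apply: T_iff_WLLPO|apply: hT_iff_hWLLPO]. Qed.
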